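(* A superconformal harmonic map from a Riemann surface $M$ to a sphere $S^{n-1}$ is never of finite uniton number.
   Context: Riemann surfaces are connected, as usual; $z$ is a local complex coordinate. Harmonic maps and finite uniton number. A smooth map $\varphi:M\to\mathrm U(n)$ is harmonic iff, with $A^\varphi_z=\frac12\varphi^{-1}\partial_z\varphi$, $A^\varphi_{\bar z}=\frac12\varphi^{-1}\partial_{\bar z}\varphi$, one has $\partial_{\bar z}A^\varphi_z+\partial_zA^\varphi_{\bar z}=0$. An extended solution associated to $\varphi$ is a smooth $\Phi:S^1\times M\to\mathrm U(n)$ with $\Phi(1,\cdot)=I$ and $\Phi^{-1}d\Phi=(1-\lambda^{-1})A^\varphi_z\,dz+(1-\lambda)A^\varphi_{\bar z}\,d\bar z$. $\varphi$ is of finite uniton number if there is an associated extended solution defined on all of $M$ that is a trigonometric polynomial $\sum_{k=-r}^sC_k(z)\lambda^k$ ($C_k$ smooth) in $\lambda\in S^1$. For maps into $\mathbb CP^{n-1}$ these notions are those of the composition with the totally geodesic Cartan embedding $\mathbb CP^{n-1}\to\mathrm U(n)$, $\alpha\mapsto\pi_\alpha-\pi_\alpha^\perp$ ($\pi_\alpha$ the Hermitian projection onto the line $\alpha$, $\pi_\alpha^\perp=\pi_{\alpha^\perp}$). A map into $\mathbb CP^{n-1}$ is identified with a line subbundle of $M\times\mathbb C^n$. Gauss bundles. For a harmonic map $\varphi$ into a Grassmannian, viewed as a subbundle of $M\times\mathbb C^n$, the Gauss bundle $G'(\varphi)$ is the image of $s\mapsto\pi_\varphi^\perp\partial_zs$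 ($s$ a section of $\varphi$), extended over the isolated points where its rank drops; it is again harmonic. $G^{(0)}(\varphi)=\varphi$, $G^{(i+1)}(\varphi)=G'(G^{(i)}(\varphi))$. The isotropy order of $\varphi$ is the greatest $t\in\{1,2,\dots,\infty\}$ such that $\varphi\perp G^{(i)}(\varphi)$ for all $1\le i\le t$. Spheres. Let $\pi:S^{n-1}\to\mathbb RP^{n-1}$ be the standard double cover of real projective space by the round sphere and $i:\mathbb RP^{n-1}\to\mathbb CP^{n-1}$ the standard inclusion; $i\circ\pi$ is totally geodesic and isometric, so $\varphi:M\to S^{n-1}$ is harmonic iff $i\circ\pi\circ\varphi:M\to\mathbb CP^{n-1}$ is harmonic. The Gauss bundles, the isotropy order and finiteness of the uniton number of $\varphi$ are those of $i\circ\pi\circ\varphi$. A harmonic map $\varphi:M\to S^{n-1}$ is superconformal if its isotropy order is the maximal finite isotropy order possible for a harmonic map into $S^{n-1}$; this is $n-1$ if $n$ is even and $n-2$ if $n$ is odd. *)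

(* Defs.v *)
From HB Require Import structures.
From mathcomp Require Import all_boot all_order all_algebra complex.
From mathcomp Require Import all_classical all_reals all_analysis.

Set Implicit Arguments.
Unset Strict Implicit.
Unset Printing Implicit Defensive.

Import Order.TTheory GRing.Theory Num.Theory numFieldNormedType.Exports.

Local Open Scope ring_scope.
Local Open Scope classical_set_scope.
Local Open Scope complex_scope.
Local Open Scope sesquilinear_scope.

Section Smoothness.
Context {R : realType} {V : normedModType R}.
Implicit Types U : set V.

(* Only used for V finite-dimensional and U open, where "all directional
   derivatives of order k exist and are continuous" is the usual C^k. *)
Fixpoint Ck (k : nat) U (f : V -> R) : Prop :=
  match k with
  | 0 => {in U, continuous f}
  | k'.+1 =>
      forall v, (forall x, U x -> derivable f x v) /\ Ck k' U ('D_v f)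
  end.

Definition smooth U (f : V -> R) : Prop := forall k, Ck k U f.

Definition smooth_mx m n U (F : V -> 'M[R[i]]_(m, n)) : Prop :=
  forall i j, smooth U (fun x => complex.Re (F x i j)) /\
              smooth U (fun x => complex.Im (F x i j)).

End Smoothness.

Section Wirtinger.
Context {R : realType} {m n : nat}.
Implicit Types F : R * R -> 'M[R[i]]_(m, n).

Definition pderive_mx (v : R * R) F (p : R * R) : 'M[R[i]]_(m, n) :=
  \matrix_(i, j) ('D_v (fun q => complex.Re (F q i j)) p +i*
                  'D_v (fun q => complex.Im (F q i j)) p).

Definition dz F (p : R * R) : 'M[R[i]]_(m, n) :=
  2^-1 *: (pderive_mx (1, 0) F p - 'i *: pderive_mx (0, 1) F p).

Definition dzbar F (p : R * R) : 'M[R[i]]_(m, n) :=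
  2^-1 *: (pderive_mx (1, 0) F p + 'i *: pderive_mx (0, 1) F p).

End Wirtinger.

Section RiemannSurfaces.
Context {R : realType}.

(* R[i]^o is R[i] with its topology and its structure of normed module over
   itself, so that [derivable] on it is complex differentiability. *)
Record chart (M : topologicalType) := Chart {
  dom : set M;
  coord : M -> R[i]^o;
  param : R[i]^o -> M
}.

Definition codom (M : topologicalType) (c : chart M) : set R[i]^o :=
  coord c @` dom c.

Definition chart_axiom (M : topologicalType) (c : chart M) : Prop :=
  [/\ open (dom c), open (codom c),
      {in dom c, continuous (coord c)}, {in codom c, continuous (param c)} &
      {in dom c, cancel (coord c) (param c)}].

Definition holomorphic_transition (M : topologicalType) (c d : chart M) : Prop :=
  forall z, (coord c @` (dom c `&` dom d)) z ->
    derivable (coord d \o param c) z 1.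

Record riemann_surface := RiemannSurface {
  surface :> topologicalType;
  atlas : set (chart surface);
  surface_hausdorff : hausdorff_space surface;
  surface_nonempty : [set: surface] !=set0;
  surface_connected : connected [set: surface];
  atlas_chart : forall c, atlas c -> chart_axiom c;
  atlas_cover : forall x, exists2 c, atlas c & dom c x;
  atlas_holomorphic : forall c d, atlas c -> atlas d ->
    holomorphic_transition c d
}.

End RiemannSurfaces.

Arguments riemann_surface R : clear implicits.
Arguments chart R M : clear implicits.

Section LocalCoordinates.
Context {R : realType} {M : topologicalType}.
Implicit Types c : chart R M.

Definition plane (p : R * R) : R[i]^o := p.1 +i* p.2.

Definition plane_coord c (x : M) : R * R := (complex.Re (coord c x), complex.Im (coord c x)).

Definition plane_codom c : set (R * R) := [set p | codom c (plane p)].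

Definition read T c (f : M -> T) : R * R -> T := fun p => f (param c (plane p)).

End LocalCoordinates.

Definition smooth_on (R : realType) (M : riemann_surface R) m n
    (W : set M) (F : M -> 'M[R[i]]_(m, n)) : Prop :=
  forall c, atlas c ->
    smooth_mx (plane_codom c `&` [set p | W (read c id p)]) (read c F).

Section UnitaryMaps.
Context {R : realType} {M : riemann_surface R} {n : nat}.
Implicit Types phi : M -> 'M[R[i]]_n.

Definition unitary_map phi : Prop :=
  smooth_on setT phi /\ forall x, phi x \is unitarymx.

Definition Az c phi (p : R * R) : 'M[R[i]]_n :=
  2^-1 *: (invmx (read c phi p) *m dz (read c phi) p).

Definition Azbar c phi (p : R * R) : 'M[R[i]]_n :=
  2^-1 *: (invmx (read c phi p) *m dzbar (read c phi) p).

Definition harmonic phi : Prop :=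
  unitary_map phi /\
  forall c, atlas c -> forall p, plane_codom c p ->
    dzbar (Az c phi) p + dz (Azbar c phi) p = 0.

Definition expi (theta : R) : R[i] := cos theta +i* sin theta.

(* Smoothness on S^1 x M is read through the local diffeomorphism expi
   from the line to S^1; values Phi l for l off S^1 are irrelevant. *)
Definition smooth_circle (Phi : R[i] -> M -> 'M[R[i]]_n) : Prop :=
  forall c, atlas c ->
    smooth_mx [set q : R * (R * R) | plane_codom c q.2]
      (fun q => read c (Phi (expi q.1)) q.2).

Definition extended_solution phi (Phi : R[i] -> M -> 'M[R[i]]_n) : Prop :=
  [/\ smooth_circle Phi,
      (forall l x, `|l| = 1 -> Phi l x \is unitarymx),
      (forall x, Phi 1 x = 1%:M) &
      forall c, atlas c -> forall l p, `|l| = 1 -> plane_codom c p ->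
        invmx (read c (Phi l) p) *m dz (read c (Phi l)) p
          = (1 - l^-1) *: Az c phi p /\
        invmx (read c (Phi l) p) *m dzbar (read c (Phi l)) p
          = (1 - l) *: Azbar c phi p].

Definition trigonometric_polynomial (Phi : R[i] -> M -> 'M[R[i]]_n) : Prop :=
  exists (r s : nat) (C : int -> M -> 'M[R[i]]_n),
    (forall k, smooth_on setT (C k)) /\
    forall l x, `|l| = 1 ->
      Phi l x = \sum_(j < (r + s).+1) l ^ (j%:Z - r%:Z) *: C (j%:Z - r%:Z) x.

Definition finite_uniton_number phi : Prop :=
  exists Phi, extended_solution phi Phi /\ trigonometric_polynomial Phi.

End UnitaryMaps.

(* A subbundle of M x C^n is represented by the Hermitian projection P x onto
   its fibre over x; its rank is constant since M is connected. *)
Section Subbundles.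
Context {R : realType} {M : riemann_surface R} {n : nat}.
Implicit Types P Q : M -> 'M[R[i]]_n.

Definition subbundle P : Prop :=
  smooth_on setT P /\ forall x, P x *m P x = P x /\ (P x)^t* = P x.

Definition fibre P (x : M) : set 'cV[R[i]]_n := [set v | P x *m v = v].

Definition orthogonal_bundles P Q : Prop :=
  forall x u v, fibre P x u -> fibre Q x v -> u^t* *m v = 0.

Definition local_section P (W : set M) (s : M -> 'cV[R[i]]_n) : Prop :=
  smooth_on W s /\ forall x, W x -> fibre P x (s x).

Definition gauss_image P (c : chart R M) (x : M) : set 'cV[R[i]]_n :=
  [set v | exists W s, [/\ open W, W x, local_section P W s &
     v = (1%:M - P x) *m dz (read c s) (plane_coord c x)]].

(* The punctured neighbourhoods say that the points where the image is not
   the fibre of Q are isolated and do not accumulate; Q is then unique. *)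
Definition is_gauss_bundle P Q : Prop :=
  subbundle Q /\
  forall c, atlas c -> forall x, dom c x ->
    \forall y \near x^', gauss_image P c y = fibre Q y.

(* The zero bundle is a default value, used only when P has no Gauss bundle;
   this does not happen for P harmonic. *)
Definition gauss_bundle P : M -> 'M[R[i]]_n :=
  xget (fun _ => 0) [set Q | is_gauss_bundle P Q].

Definition isotropic_upto P (t : nat) : Prop :=
  forall i, (1 <= i <= t)%N -> orthogonal_bundles P (iter i gauss_bundle P).

(* "the isotropy order of P is finite and equal to t" *)
Definition isotropy_order P (t : nat) : Prop :=
  [/\ (1 <= t)%N, isotropic_upto P t &
      forall t', isotropic_upto P t' -> (t' <= t)%N].

Definition cartan P : M -> 'M[R[i]]_n := fun x => P x - (1%:M - P x).

End Subbundles.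

(* The maximal finite isotropy order of a harmonic map into S^(n-1).  The
   truncated value 0 at n = 0 and n = 1 is not an isotropy order: there are
   then no superconformal maps. *)
Definition max_isotropy_order (n : nat) : nat := if odd n then n.-2 else n.-1.

Section Spheres.
Context {R : realType} {M : riemann_surface R} {n : nat}.
Implicit Types phi : M -> 'cV[R]_n.

Definition complexify phi : M -> 'cV[R[i]]_n :=
  fun x => map_mx (real_complex R) (phi x).

Definition sphere_map phi : Prop :=
  smooth_on setT (complexify phi) /\ forall x, (phi x)^T *m phi x = 1%:M.

(* The line subbundle given by the composition of phi with the maps
   S^(n-1) -> RP^(n-1) -> CP^(n-1): for a unit vector v, the projection onto
   the line spanned by v is v v^*. *)
Definition line_bundle phi : M -> 'M[R[i]]_n :=
  fun x => complexify phi x *m (complexify phi x)^t*.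

Definition sphere_harmonic phi : Prop :=
  sphere_map phi /\ harmonic (cartan (line_bundle phi)).

Definition sphere_finite_uniton_number phi : Prop :=
  finite_uniton_number (cartan (line_bundle phi)).

Definition superconformal phi : Prop :=
  sphere_harmonic phi /\
  isotropy_order (line_bundle phi) (max_isotropy_order n).

End Spheres.

(* Main.v *)
Require Import Defs.
From mathcomp Require Import all_boot all_order all_algebra complex.
From mathcomp Require Import all_classical all_reals all_analysis.
From HB Require Import structures.
From mathcomp Require Import zify ring lra.

(** The position vector v of the map is real of length one, so orthogonality to
the line bundle of v is expressed by the complex bilinear form
(u, w) = u^T w.  If the isotropy order is t, then (v, d^k v) = 0 for
0 < k <= t, with d the derivative with respect to z, while
h = (v, d^(t+1) v) is nonzero somewhere ([bform_jet], [bform_jet_last]).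
Indeed d^k v is a section of the k-th Gauss bundle up to sections of the
previous ones, and away from isolated points that section spans the k-th Gauss
bundle.

Let Phi be an extended solution which is a Laurent polynomial in l, and put
A = v (dv)^T - dv v^T, which is the form A_z of the Cartan embedding.  From
d Phi = (1 - l^-1) Phi A one gets d^m (Phi v) = Phi X_m with X_m = nabla^m v
and nabla = d + (1 - l^-1) A ([derivation_frame]); X_m is a polynomial in l^-1
with vector coefficients.  The operator nabla drives v around a cycle of length
N = t + 1:

  v -> l^-1 dv -> l^-1 d^2 v -> ... -> l^-1 d^t v -> l^-2 h v,

and everything else that it produces lags behind this leading term.  So the
coefficient of l^(-2q) in X_(qN) is h^q v up to sign
([closing_spectral_jet]).  On the unit circle Phi^-1 = Phi^*, hence
X_m = Phi^* d^m (Phi v) involves only a range of powers of l which does not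
depend on m.  Taking q large forces h = 0 ([finite_uniton_jet]), which is a
contradiction: the isotropy order of a map of finite uniton number is never
finite ([isotropy_order_not_finite_uniton]).

All computations take place in the domain of one chart.  The smooth functions
on it form a commutative ring with the derivation d ([smoothfun], [deriv]), so
that the algebra above is carried out over an abstract differential ring. *)

Set Implicit Arguments.
Unset Strict Implicit.
Unset Printing Implicit Defensive.
Import Order.TTheory GRing.Theory Num.Theory numFieldNormedType.Exports.
Local Open Scope ring_scope.

(** * The cycle of length N over a differential ring *)

Section DifferentialRing.
Context {K : comNzRingType} (d : {additive K -> K}).
Hypothesis dM : forall a b, d (a * b) = d a * b + a * d b.

Lemma derivation1 : d 1 = 0.
Proof.
by have /eqP := dM 1 1; rewrite !mulr1 mul1r addrC -subr_eq subrr => /eqP.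
Qed.

Lemma derivation_mulmx m n p (F : 'M[K]_(m, n)) (G : 'M[K]_(n, p)) :
  map_mx d (F *m G) = map_mx d F *m G + F *m map_mx d G.
Proof.
apply/matrixP => i j; rewrite !mxE raddf_sum -big_split /=.
by apply: eq_bigr => k _; rewrite dM !mxE.
Qed.

Lemma derivationZ m n a (F : 'M[K]_(m, n)) :
  map_mx d (a *: F) = d a *: F + a *: map_mx d F.
Proof. by apply/matrixP => i j; rewrite !mxE dM. Qed.

Context {n : nat}.
Implicit Types u v w : 'cV[K]_n.

Definition bform u w : K := (u^T *m w) 0 0.

Lemma bformC u w : bform u w = bform w u.
Proof. by rewrite /bform -[in LHS](trmxK w) -trmx_mul mxE. Qed.

Lemma bformDr u w w' : bform u (w + w') = bform u w + bform u w'.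
Proof. by rewrite /bform mulmxDr mxE. Qed.

Lemma bformBr u w w' : bform u (w - w') = bform u w - bform u w'.
Proof. by rewrite /bform mulmxBr !mxE. Qed.

Lemma bformNr u w : bform u (- w) = - bform u w.
Proof. by rewrite /bform mulmxN mxE. Qed.

Lemma bformZr u a w : bform u (a *: w) = a * bform u w.
Proof. by rewrite /bform -scalemxAr mxE. Qed.

Lemma bform0r u : bform u 0 = 0.
Proof. by rewrite /bform mulmx0 mxE. Qed.

Lemma mulmx_bform u w w' : u *m w^T *m w' = bform w w' *: u.
Proof. by rewrite -mulmxA [w^T *m w']mx11_scalar mul_mx_scalar. Qed.

Lemma derivation_bform u w :
  d (bform u w) = bform (map_mx d u) w + bform u (map_mx d w).
Proof.
have /matrixP/(_ 0 0) := derivation_mulmx u^T w.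
by rewrite /bform !mxE -matrix.map_trmx.
Qed.

Section Filtration.
Variable v : 'cV[K]_n.

Definition jet k : 'cV[K]_n := iter k (map_mx d) v.

(** For v of unit length this is half of G^-1 dG, where G = 2 v v^T - 1 is the
reflection that represents the line of v; see [derivation_reflection]. *)
Definition rotation : 'M[K]_n := v *m (jet 1)^T - jet 1 *m v^T.

Lemma rotationE u : rotation *m u = bform (jet 1) u *: v - bform v u *: jet 1.
Proof. by rewrite mulmxBl !mulmx_bform. Qed.

(** The connection d + (1 - nu) A, with nu = l^-1, acting on polynomials in nu
with vector coefficients; x j is the coefficient of nu^j. *)
Definition nabla (x : nat -> 'cV[K]_n) (j : nat) : 'cV[K]_n :=
  map_mx d (x j) + rotation *m x j
  - (if j is j'.+1 then rotation *m x j' else 0).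

Definition spectral_jet m : nat -> 'cV[K]_n :=
  iter m nabla (fun j => if j is 0 then v else 0).

Lemma spectral_jet_eq0 m j : (m < j)%N -> spectral_jet m j = 0.
Proof.
elim: m j => [|m IH] [//|j] mj //=.
by rewrite /nabla -/(spectral_jet m) !IH ?mulmx0 ?raddf0 ?addr0 ?subr0 //; lia.
Qed.

(** The equation of the extended solution says that Phi intertwines d with the
connection, so repeated differentiation of Phi v amounts to iterating the
connection on v.  Any bound B above the degree m can be used. *)
Lemma derivation_frame (Phi : 'M[K]_n) (nu : K) m B : (m < B)%N ->
  d nu = 0 -> map_mx d Phi = (1 - nu) *: (Phi *m rotation) ->
  iter m (map_mx d) (Phi *m v) =
  Phi *m \sum_(j < B) nu ^+ j *: spectral_jet m j.
Proof.
move=> mB nu0 dPhi; elim: m B mB => [|m IH] [//|B] mB.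
  by rewrite big_ord_recl expr0 scale1r big1 ?addr0 // => i _; rewrite scaler0.
have dnu j : d (nu ^+ j) = 0.
  elim: j => [|j IHj]; first exact: derivation1.
  by rewrite exprS dM nu0 IHj mul0r mulr0 addr0.
rewrite iterS (IH B.+1) ?(ltn_trans _ mB) // derivation_mulmx dPhi.
rewrite -scalemxAl -mulmxA [_ *: (Phi *m _)]scalemxAr -mulmxDr; congr (_ *m _).
rewrite mulmx_sumr scaler_sumr [map_mx d _]raddf_sum -big_split /=.
(* The two shifts of the index: the terms r keep the degree in nu and the terms
   s raise it by one. *)
pose r j :=
  nu ^+ j *: (map_mx d (spectral_jet m j) + rotation *m spectral_jet m j).
pose s j := nu ^+ j.+1 *: (rotation *m spectral_jet m j).
transitivity (\sum_(j < B.+1) r j - \sum_(j < B.+1) s j).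
  rewrite -sumrB; apply: eq_bigr => j _; rewrite /r /s derivationZ dnu.
  rewrite scale0r add0r -scalemxAr exprS -!scalerA scalerBl scale1r scalerDr.
  by rewrite addrC [nu *: (_ *: _)]scalerA addrA.
rewrite [\sum_(j < B.+1) s j]big_ord_recr /= {2}/s.
rewrite spectral_jet_eq0 // mulmx0 scaler0 addr0.
rewrite big_ord_recl [in RHS]big_ord_recl -addrA; congr (_ + _).
  by rewrite /r /= /nabla subr0.
rewrite -sumrB; apply: eq_bigr => j _; rewrite /r /s /= /nabla.
by rewrite -scalerBr.
Qed.

Section Isotropic.
Variable N : nat.
Hypothesis N_gt1 : (1 < N)%N.
Hypothesis bform_vv : bform v v = 1.
Hypothesis bform_v_jet : forall k, (0 < k < N)%N -> bform v (jet k) = 0.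

Local Notation h := (bform v (jet N)).

Definition reflection : 'M[K]_n := v *m v^T *+ 2 - 1%:M.

Lemma reflectionK : reflection *m reflection = 1%:M.
Proof.
rewrite /reflection mulr2n mulmxBl mul1mx mulmxDl mulmxBr mulmx1 mulmxDr.
rewrite mulmxA mulmx_bform bform_vv scale1r addrK.
by rewrite opprB addrC subrK.
Qed.

Lemma derivation_reflection :
  map_mx d reflection = (reflection *m rotation) *+ 2.
Proof.
have vr : v *m v^T *m rotation = v *m (jet 1)^T.
  rewrite mulmxBr !mulmxA !mulmx_bform bform_vv scale1r.
  by rewrite (bform_v_jet (k := 1)) // scale0r mul0mx subr0.
rewrite /reflection mulr2n raddfB raddfD /= derivation_mulmx -matrix.map_trmx.
have -> : map_mx d 1%:M = 0 :> 'M[K]_n.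
  apply/matrixP => i j; rewrite !mxE.
  by case: (i == j); rewrite ?mulr1n ?mulr0n ?derivation1 ?raddf0.
rewrite subr0 mulmxBl mul1mx mulmxDl vr mulr2n /rotation -/(jet 1).
by rewrite opprB [_ + (_ - _)]addrC [_ - _ + (_ + _)]addrA subrK.
Qed.

Lemma bform_jet1_jet k : (k < N)%N ->
  bform (jet 1) (jet k) = - bform v (jet k.+1).
Proof.
move=> kN; apply/eqP; rewrite -addr_eq0 -derivation_bform.
case: k kN => [|k] kN; first by rewrite bform_vv derivation1.
by rewrite bform_v_jet ?raddf0.
Qed.

Lemma bform_jet1_jet0 k : (k.+1 < N)%N -> bform (jet 1) (jet k) = 0.
Proof. by move=> kN; rewrite bform_jet1_jet ?bform_v_jet ?oppr0 // ltnW. Qed.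

Lemma bform_jet_rotation k u :
  bform (jet k) (rotation *m u) =
  bform (jet k) v * bform (jet 1) u - bform (jet k) (jet 1) * bform v u.
Proof. by rewrite rotationE bformBr !bformZr mulrC [bform v u * _]mulrC. Qed.

(** The values of A lie in the span of v and dv, and both are orthogonal to
d^k v for 0 < k < N - 1, because (dv, d^k v) = - (v, d^(k+1) v). *)
Lemma bform_jet_rotation0 k u : (0 < k)%N -> (k.+1 < N)%N ->
  bform (jet k) (rotation *m u) = 0.
Proof.
move=> k0 kN; rewrite bform_jet_rotation [bform _ v]bformC bform_v_jet;
  last by rewrite k0 ltnW.
by rewrite [bform (jet k) _]bformC bform_jet1_jet0 // !mul0r subr0.
Qed.

Lemma bform_jet_derivation k u :
  bform (jet k) (map_mx d u) = d (bform (jet k) u) - bform (jet k.+1) u.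
Proof. by rewrite derivation_bform addrC addKr. Qed.

(** The normal form after q full turns: the cycle is back on the line of v. *)
Definition closing (q : nat) (a : K) (x : nat -> 'cV[K]_n) :=
  (forall j, (2 * q < j)%N -> x j = 0) /\ x (2 * q)%N = a *: v.

(** The state i steps after q full turns, for 0 < i < N.  The leading
coefficient, in degree 2q + 1, morally is a d^i v plus terms in d^j v with
0 < j < i, and the next one is a combination of the d^j v with j <= i.  This is
recorded through the products with the jets: they are what the connection
sees, and their evolution needs no coefficients to be named. *)
Definition passing (q i : nat) (a : K) (x : nat -> 'cV[K]_n) :=
  [/\ forall j, ((2 * q).+1 < j)%N -> x j = 0,
      forall k, (k + i < N)%N -> bform (jet k) (x (2 * q).+1) = 0,
      bform (jet (N - i)) (x (2 * q).+1) = (-1) ^+ i * a * h &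
      forall k, (0 < k)%N -> (k + i < N)%N -> bform (jet k) (x (2 * q)%N) = 0].

Lemma nabla_closing q a x : closing q a x -> passing q 1 a (nabla x).
Proof.
move=> [x0 xq].
have rv : rotation *m x (2 * q)%N = - a *: jet 1.
  rewrite xq -scalemxAr rotationE bform_vv scale1r.
  by rewrite (bform_jet1_jet0 (k := 0)) // scale0r sub0r scalerN scaleNr.
have x1 : nabla x (2 * q).+1 = a *: jet 1.
  by rewrite /nabla rv x0 // mulmx0 raddf0 addr0 sub0r scaleNr opprK.
split.
- move=> [//|j] jq; rewrite /nabla !x0 ?mulmx0 ?raddf0 ?addr0 ?subr0 //; lia.
- move=> k kN; rewrite x1 bformZr bformC bform_jet1_jet0 ?mulr0 //; lia.
- rewrite x1 bformZr bformC bform_jet1_jet; last by lia.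
  by rewrite -[(N - 1).+1]/(N - 1).+1 subn1 prednK 1?ltnW //; ring.
- move=> k k0 kN; have k1N : (k.+1 < N)%N by lia.
  rewrite /nabla !bformDr bform_jet_derivation bform_jet_rotation0 // addr0.
  rewrite xq !bformZr [bform _ v]bformC bform_v_jet ?k0 1?ltnW //.
  rewrite [bform _ v]bformC bform_v_jet // !mulr0 raddf0 subr0 add0r bformNr.
  by case: (2 * q)%N => [|j]; rewrite ?bform0r ?bform_jet_rotation0 ?oppr0.
Qed.

(** In the leading degree the connection acts by differentiation, up to
A x (2q), which is orthogonal to all jets that matter.  Since
(d^k v, du) = d (d^k v, u) - (d^(k+1) v, u), each step gives up one vanishing
product and moves the first nonzero one down by one jet, with a sign. *)
Lemma nabla_passing q i a x : (0 < i)%N -> (i.+1 < N)%N ->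
  passing q i a x -> passing q i.+1 a (nabla x).
Proof.
move=> i0 iN [x0 xu xt xw].
have ru : rotation *m x (2 * q).+1 = 0.
  by rewrite rotationE (xu 0%N) ?(xu 1%N) ?scale0r ?subr0 //; lia.
split.
- move=> [//|j] jq; rewrite /nabla x0 // mulmx0 raddf0 addr0 sub0r.
  have [->|jq'] := eqVneq j (2 * q).+1; first by rewrite ru oppr0.
  by rewrite x0 ?mulmx0 ?oppr0 //; lia.
- move=> k kN; rewrite /nabla ru addr0 bformBr bform_jet_derivation.
  rewrite !xu ?raddf0 ?addr0 ?sub0r; [|lia..].
  have [->|k0] := posnP k; last by rewrite bform_jet_rotation0 ?oppr0 //; lia.
  rewrite bform_jet_rotation bform_vv (xw 1%N) //.
  by rewrite [bform _ (jet 1)]bform_v_jet ?mul0r ?mulr0 ?subr0 ?oppr0.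
- rewrite /nabla ru addr0 bformBr bform_jet_derivation xu; last by lia.
  rewrite raddf0 sub0r; have -> : (N - i.+1).+1 = (N - i)%N by lia.
  by rewrite xt bform_jet_rotation0 ?subr0 ?exprS; [ring|lia..].
- move=> k k0 kN; rewrite /nabla bformBr bformDr bform_jet_derivation.
  rewrite !xw ?raddf0; [|lia..].
  rewrite bform_jet_rotation0 //; last by lia.
  case: (2 * q)%N => [|j]; first by rewrite bform0r ?subr0 ?addr0.
  by rewrite bform_jet_rotation0 ?subr0 ?addr0 //; lia.
Qed.

(** At the end of the turn the leading coefficient u satisfies (v, u) = 0 and
(dv, u) = + a h or - a h, so - A u is a multiple of v: the degree rises
and the cycle closes. *)
Lemma nabla_passing_last q a x :
  passing q N.-1 a x -> closing q.+1 ((-1) ^+ N * a * h) (nabla x).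
Proof.
move=> [x0 xu xt xw]; have N2 : (2 * q.+1 = (2 * q).+2)%N by lia.
split; rewrite N2.
  by move=> [//|j] jq; rewrite /nabla !x0 ?mulmx0 ?raddf0 ?addr0 ?subr0 //; lia.
rewrite /nabla x0 // mulmx0 raddf0 addr0 sub0r rotationE (xu 0%N); last by lia.
move: xt; have -> : (N - N.-1 = 1)%N by lia.
move=> ->; rewrite scale0r subr0 -scaleNr.
have -> : (-1) ^+ N = -1 * (-1) ^+ N.-1 :> K by rewrite -exprS prednK // ltnW.
by congr (_ *: _); ring.
Qed.

Lemma iter_nabla_closing q a x :
  closing q a x -> closing q.+1 ((-1) ^+ N * a * h) (iter N nabla x).
Proof.
move=> xq; rewrite -(prednK (ltnW N_gt1)) iterS.
rewrite (prednK (ltnW N_gt1)); apply: nabla_passing_last.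
have : (0 < N.-1 < N)%N by lia.
elim: N.-1 => [//|[_ _|i IH /andP[i0 iN]]]; first exact: nabla_closing.
by rewrite iterS; apply: nabla_passing => //; apply: IH; lia.
Qed.

Lemma closing_spectral_jet q :
  closing q (((-1) ^+ N * h) ^+ q) (spectral_jet (q * N)).
Proof.
elim: q => [|q IH]; first by split=> [[]//|]; rewrite expr0 scale1r.
by rewrite mulSn /spectral_jet iterD exprS mulrAC; apply: iter_nabla_closing.
Qed.

End Isotropic.
End Filtration.
End DifferentialRing.

Local Open Scope classical_set_scope.
Local Open Scope complex_scope.
Local Open Scope sesquilinear_scope.

(** * Calculus of smooth functions on an open set of the plane *)

Section RealSmooth.
Context {R : realType} {V : normedModType R} {U : set V}.
Hypothesis openU : open U.
Implicit Types f g : V -> R.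

Lemma near_open (P : V -> Prop) x : U x -> (forall y, U y -> P y) ->
  \forall y \near x, P y.
Proof. by move=> Ux UP; apply: filterS UP _; apply: open_nbhs_nbhs. Qed.

(** Smoothness on U constrains the function on U alone, although the
directional derivatives are functions on the whole space. *)
Lemma Ck_eq k f g : {in U, f =1 g} -> Ck k U f -> Ck k U g.
Proof.
elim: k f g => [|k IH] f g fg /=.
  move=> cf x Ux; have := cf x Ux; move: Ux; rewrite inE => Ux.
  rewrite /prop_for /continuous_at -fg ?inE // => cfx.
  apply: cvg_trans cfx; apply: near_eq_cvg.
  by apply: near_open => // y Uy; rewrite fg ?inE.
move=> df v; have [dfv Dfv] := df v.
have fgn x : U x -> \forall y \near x, f y = g y.
  by move=> Ux; apply: near_open => // y Uy; rewrite fg ?inE.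
split=> [x Ux|]; first by apply: (near_eq_derivable (fgn x Ux)); apply: dfv.
by apply: IH Dfv => x; rewrite inE => Ux; apply/near_eq_derive/fgn.
Qed.

Lemma smooth_derivable f x v : smooth U f -> U x -> derivable f x v.
Proof. by move=> /(_ 1%N) /(_ v)[+ _] => /[apply]. Qed.

Lemma smooth_derive f v : smooth U f -> smooth U ('D_v f).
Proof. by move=> sf k; have [] := sf k.+1 v. Qed.

Lemma smooth_cst a : smooth U (cst a).
Proof.
move=> k; elim: k a => [|k IH] a /=; first by move=> x _; apply: cst_continuous.
move=> v; split=> [x _|]; first exact: derivable_cst.
by apply: Ck_eq (IH 0) => x _; rewrite derive_cst.
Qed.

Lemma CkD k f g : Ck k U f -> Ck k U g -> Ck k U (f \+ g).
Proof.
elim: k f g => [|k IH] f g /= df dg.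
  by move=> x Ux; apply: continuousD; [apply: df|apply: dg].
move=> v; have [[dfv Dfv] [dgv Dgv]] := (df v, dg v).
split=> [x Ux|]; first by apply: derivableD; [apply: dfv|apply: dgv].
apply: Ck_eq (IH _ _ Dfv Dgv) => x; rewrite inE => Ux.
by rewrite [RHS]deriveD //; [apply: dfv|apply: dgv].
Qed.

Lemma smoothD f g : smooth U f -> smooth U g -> smooth U (f \+ g).
Proof. by move=> sf sg k; apply: CkD. Qed.

Lemma smoothM f g : smooth U f -> smooth U g -> smooth U (f \* g).
Proof.
move=> + + k; elim: k f g => [|k IH] f g sf sg /=.
  by move=> x Ux; apply: continuousM; [apply: (sf 0%N)|apply: (sg 0%N)].
move=> v; split=> [x Ux|]; first by apply: derivableM; apply: smooth_derivable.
have := CkD (IH _ _ sf (smooth_derive v sg)) (IH _ _ sg (smooth_derive v sf)).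
apply: Ck_eq => x.
by rewrite inE => Ux; rewrite [RHS]deriveM //; apply: smooth_derivable.
Qed.

Lemma smoothN f : smooth U f -> smooth U (\- f).
Proof.
move=> /(smoothM (smooth_cst (-1))) sf k; apply: Ck_eq (sf k) => x _ /=.
by rewrite mulN1r.
Qed.

Lemma derive_mul_sub f g f' g' x v :
  derivable f x v -> derivable g x v -> derivable f' x v -> derivable g' x v ->
  'D_v (fun q => f q * g q - f' q * g' q) x =
  f x * 'D_v g x + g x * 'D_v f x - (f' x * 'D_v g' x + g' x * 'D_v f' x).
Proof.
move=> df dg df' dg'.
have E := deriveB (derivableM df dg) (derivableM df' dg').
by rewrite (deriveM df dg) (deriveM df' dg') in E.
Qed.

Lemma derive_mul_add f g f' g' x v :
  derivable f x v -> derivable g x v -> derivable f' x v -> derivable g' x v ->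
  'D_v (fun q => f q * g q + f' q * g' q) x =
  f x * 'D_v g x + g x * 'D_v f x + (f' x * 'D_v g' x + g' x * 'D_v f' x).
Proof.
move=> df dg df' dg'.
have E := deriveD (derivableM df dg) (derivableM df' dg').
by rewrite (deriveM df dg) (deriveM df' dg') in E.
Qed.

End RealSmooth.

Section ComplexSmooth.
Context {R : realType} {U : set (R * R)}.
Hypothesis openU : open U.
Implicit Types f g : R * R -> R[i].

Definition csmooth (W : set (R * R)) f :=
  smooth W (fun p => complex.Re (f p)) /\ smooth W (fun p => complex.Im (f p)).

Definition cderive (v : R * R) f (p : R * R) : R[i] :=
  'D_v (fun q => complex.Re (f q)) p +i* 'D_v (fun q => complex.Im (f q)) p.

(** The operator d/dz on scalar functions; [dz] is its entrywise version. *)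
Definition wirtinger f (p : R * R) : R[i] :=
  2^-1 * (cderive (1, 0) f p - 'i * cderive (0, 1) f p).

Lemma dzE m n (F : R * R -> 'M[R[i]]_(m, n)) p i j :
  dz F p i j = wirtinger (fun q => F q i j) p.
Proof. by rewrite !mxE. Qed.

Lemma csmooth_cst a : csmooth U (cst a).
Proof. by split; apply: smooth_cst. Qed.

Lemma csmoothD f g : csmooth U f -> csmooth U g -> csmooth U (f \+ g).
Proof.
move=> [sfr sfi] [sgr sgi]; split=> k;
  [apply: Ck_eq (smoothD openU sfr sgr k)
  |apply: Ck_eq (smoothD openU sfi sgi k)];
  by move=> // x _ /=; case: (f x) (g x) => ? ? [].
Qed.

Lemma csmoothM f g : csmooth U f -> csmooth U g -> csmooth U (f \* g).
Proof.
move=> [sfr sfi] [sgr sgi]; split=> k.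
- apply: Ck_eq (smoothD openU (smoothM openU sfr sgr)
    (smoothN openU (smoothM openU sfi sgi)) k) => // x _ /=.
  by case: (f x) (g x) => ? ? [].
- apply: Ck_eq (smoothD openU (smoothM openU sfr sgi)
    (smoothM openU sfi sgr) k) => // x _ /=.
  by case: (f x) (g x) => ? ? [].
Qed.

Lemma csmoothN f : csmooth U f -> csmooth U (\- f).
Proof.
move=> [sfr sfi]; split=> k;
  [apply: Ck_eq (smoothN openU sfr k)|apply: Ck_eq (smoothN openU sfi k)];
  by move=> // x _ /=; case: (f x).
Qed.

Lemma csmooth_eq f g : (forall p, U p -> f p = g p) ->
  csmooth U f -> csmooth U g.
Proof.
move=> fg [sfr sfi]; split=> k; [apply: Ck_eq (sfr k)|apply: Ck_eq (sfi k)];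
  by move=> // x; rewrite inE => Ux; rewrite fg.
Qed.

Lemma csmooth_cderive v f : csmooth U f -> csmooth U (cderive v f).
Proof. by move=> [sr si]; split; apply: smooth_derive. Qed.

Lemma csmooth_wirtinger f : csmooth U f -> csmooth U (wirtinger f).
Proof.
move=> sf; apply: csmoothM; first exact: csmooth_cst.
apply: csmoothD; first exact: csmooth_cderive.
apply/csmoothN/csmoothM; [exact: csmooth_cst|exact: csmooth_cderive].
Qed.

Lemma cderiveD v f g p : csmooth U f -> csmooth U g -> U p ->
  cderive v (f \+ g) p = cderive v f p + cderive v g p.
Proof.
move=> [sfr sfi] [sgr sgi] Up; rewrite /cderive.
have Re_add : (fun q => complex.Re ((f \+ g) q)) =
    (fun q => complex.Re (f q)) \+ (fun q => complex.Re (g q)).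
  by apply/funext => q /=; case: (f q) (g q) => ? ? [].
have Im_add : (fun q => complex.Im ((f \+ g) q)) =
    (fun q => complex.Im (f q)) \+ (fun q => complex.Im (g q)).
  by apply/funext => q /=; case: (f q) (g q) => ? ? [].
rewrite Re_add Im_add.
by rewrite !deriveD //; apply: (smooth_derivable (U := U)).
Qed.

Lemma cderiveM v f g p : csmooth U f -> csmooth U g -> U p ->
  cderive v (f \* g) p = cderive v f p * g p + f p * cderive v g p.
Proof.
move=> [sfr sfi] [sgr sgi] Up; rewrite /cderive.
pose fr q := complex.Re (f q); pose fi q := complex.Im (f q).
pose gr q := complex.Re (g q); pose gi q := complex.Im (g q).
have Re_mul : (fun q => complex.Re ((f \* g) q)) =
    (fun q => fr q * gr q - fi q * gi q).
  by apply/funext => q; rewrite /fr /fi /gr /gi /=; case: (f q) (g q) => ? ? [].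
have Im_mul : (fun q => complex.Im ((f \* g) q)) =
    (fun q => fr q * gi q + fi q * gr q).
  by apply/funext => q; rewrite /fr /fi /gr /gi /=; case: (f q) (g q) => ? ? [].
have dfr : derivable fr p v := smooth_derivable (v := v) sfr Up.
have dfi : derivable fi p v := smooth_derivable (v := v) sfi Up.
have dgr : derivable gr p v := smooth_derivable (v := v) sgr Up.
have dgi : derivable gi p v := smooth_derivable (v := v) sgi Up.
rewrite Re_mul Im_mul (derive_mul_sub dfr dgr dfi dgi).
rewrite (derive_mul_add dfr dgi dfi dgr).
have -> : g p = gr p +i* gi p by rewrite /gr /gi; case: (g p).
have -> : f p = fr p +i* fi p by rewrite /fr /fi; case: (f p).
rewrite -/fr -/fi -/gr -/gi.
move: ('D_v fr p) ('D_v fi p) ('D_v gr p) ('D_v gi p).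
move: (fr p) (fi p) (gr p) (gi p) => a b c e a' b' c' e'.
by apply/eqP; rewrite eq_complex /=; apply/andP; split; apply/eqP; ring.
Qed.

Lemma wirtingerD f g p : csmooth U f -> csmooth U g -> U p ->
  wirtinger (f \+ g) p = wirtinger f p + wirtinger g p.
Proof.
move=> sf sg Up; rewrite /wirtinger !cderiveD //.
move: (cderive _ f p) (cderive _ f p) (cderive _ g p) (cderive _ g p) => *.
ring.
Qed.

Lemma wirtingerM f g p : csmooth U f -> csmooth U g -> U p ->
  wirtinger (f \* g) p = wirtinger f p * g p + f p * wirtinger g p.
Proof.
move=> sf sg Up; rewrite /wirtinger !cderiveM //.
move: (cderive _ f p) (cderive _ f p) (cderive _ g p) (cderive _ g p) => *.
ring.
Qed.

Lemma wirtinger_near f g p : (\near p, f p = g p) ->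
  wirtinger f p = wirtinger g p.
Proof.
move=> fg; suff E v : cderive v f p = cderive v g p by rewrite /wirtinger !E.
rewrite /cderive; congr (_ +i* _); apply: near_eq_derive;
  by apply: filterS fg => q ->.
Qed.

Lemma wirtinger_cst a p : wirtinger (cst a) p = 0.
Proof.
rewrite /wirtinger /cderive !derive_cst.
by rewrite mulr0 subr0 mulr0.
Qed.

End ComplexSmooth.

(** * The differential ring of smooth functions *)

Section SmoothRing.
Context {R : realType} {U : set (R * R)} (openU : open U).

(** The openness of U is a parameter because the ring structure, which is
inferred from the type, relies on it. *)
Definition smooth_pred (_ : open U) : {pred R * R -> R[i]} :=
  fun f => `[< csmooth U f >].

Lemma smooth_predP f : reflect (csmooth U f) (f \in smooth_pred openU).
Proof. exact: asboolP. Qed.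

Record smoothfun := SmoothFun {
  smoothfun_val :> R * R -> R[i];
  _ : smoothfun_val \in smooth_pred openU
}.

HB.instance Definition _ := [isSub for smoothfun_val].
HB.instance Definition _ := [Choice of smoothfun by <:].

Lemma smooth_subring : subring_closed (smooth_pred openU).
Proof.
split.
- by apply/smooth_predP; apply: csmooth_cst.
- move=> f g /smooth_predP sf /smooth_predP sg; apply/smooth_predP.
  exact: csmoothD (csmoothN _ sg).
- move=> f g /smooth_predP sf /smooth_predP sg; apply/smooth_predP.
  exact: csmoothM.
Qed.

HB.instance Definition _ := GRing.SubChoice_isSubComNzRing.Build
  _ _ smoothfun smooth_subring.

Lemma smoothfun_smooth (f : smoothfun) : csmooth U f.
Proof. by apply/smooth_predP; case: f. Qed.

Lemma smoothfun_eq (f g : smoothfun) : (forall p, f p = g p) -> f = g.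
Proof. by move=> fg; apply/val_inj/funext. Qed.

Lemma smoothfunD (f g : smoothfun) p : (f + g) p = f p + g p.
Proof. by []. Qed.

Lemma smoothfunM (f g : smoothfun) p : (f * g) p = f p * g p.
Proof. by []. Qed.

Definition eval_at (p : R * R) (f : smoothfun) : R[i] := f p.

Fact eval_at_additive p : zmod_morphism (eval_at p).
Proof. by move=> f g; rewrite /eval_at -[LHS]/(val (f - g) p) rmorphB. Qed.

HB.instance Definition _ p :=
  GRing.isZmodMorphism.Build smoothfun R[i] (eval_at p) (eval_at_additive p).

Fact eval_at_monoid p : monoid_morphism (eval_at p).
Proof. by split=> [|f g]; rewrite /eval_at. Qed.

HB.instance Definition _ p :=
  GRing.isMonoidMorphism.Build smoothfun R[i] (eval_at p) (eval_at_monoid p).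

(** Elements of the ring are functions on the whole plane, about which nothing
is known outside U.  Cutting the derivative off there makes the Leibniz rule an
identity between such functions. *)
Definition wirtinger_ext (f : R * R -> R[i]) (p : R * R) : R[i] :=
  if `[< U p >] then wirtinger f p else 0.

Lemma csmooth_wirtinger_ext f : csmooth U f -> csmooth U (wirtinger_ext f).
Proof.
move=> sf; apply: csmooth_eq (csmooth_wirtinger openU sf) => // p Up.
by rewrite /wirtinger_ext asboolT.
Qed.

Definition deriv (f : smoothfun) : smoothfun :=
  SmoothFun (introT (smooth_predP _)
    (csmooth_wirtinger_ext (smoothfun_smooth f))).

Lemma derivE f p : U p -> deriv f p = wirtinger f p.
Proof. by move=> Up; rewrite /= /wirtinger_ext asboolT. Qed.

Lemma deriv_off f p : ~ U p -> deriv f p = 0.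
Proof. by move=> nUp; rewrite /= /wirtinger_ext asboolF. Qed.

Lemma derivD f g : deriv (f + g) = deriv f + deriv g.
Proof.
apply: smoothfun_eq => p; rewrite smoothfunD.
have [Up|nUp] := pselect (U p); last by rewrite !deriv_off ?addr0.
have sf := smoothfun_smooth f; have sg := smoothfun_smooth g.
by rewrite !derivE // -(wirtingerD sf sg Up).
Qed.

Fact deriv_nmod : nmod_morphism deriv.
Proof.
split; last exact: derivD.
by have /eqP := derivD 0 0; rewrite addr0 -subr_eq subrr => /eqP.
Qed.

HB.instance Definition _ :=
  GRing.isNmodMorphism.Build smoothfun smoothfun deriv deriv_nmod.

Lemma derivM f g : deriv (f * g) = deriv f * g + f * deriv g.
Proof.
apply: smoothfun_eq => p; rewrite smoothfunD !smoothfunM.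
have [Up|nUp] := pselect (U p); last by rewrite !deriv_off ?mulr0 ?mul0r ?addr0.
have sf := smoothfun_smooth f; have sg := smoothfun_smooth g.
by rewrite !derivE // -(wirtingerM sf sg Up).
Qed.

Definition constfun (a : R[i]) : smoothfun :=
  SmoothFun (introT (smooth_predP _) (csmooth_cst openU a)).

Lemma deriv_const a : deriv (constfun a) = 0.
Proof.
apply: smoothfun_eq => p; rewrite -[RHS]/(eval_at p 0) rmorph0.
have [Up|/deriv_off//] := pselect (U p).
by rewrite derivE //= wirtinger_cst.
Qed.

Section Matrices.
Context {m n : nat}.
Implicit Types F : R * R -> 'M[R[i]]_(m, n).

Definition eval_mx p (F : 'M[smoothfun]_(m, n)) : 'M[R[i]]_(m, n) :=
  map_mx (eval_at p) F.

Lemma smoothmx_eq (F G : 'M[smoothfun]_(m, n)) :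
  (forall p, eval_mx p F = eval_mx p G) -> F = G.
Proof.
move=> FG; apply/matrixP => i j; apply: smoothfun_eq => p.
by have /matrixP/(_ i j) := FG p; rewrite !mxE.
Qed.

Definition smoothmx F (sF : smooth_mx U F) : 'M[smoothfun]_(m, n) :=
  \matrix_(i, j)
    SmoothFun (introT (smooth_predP (fun p => F p i j)) (sF i j)).

Lemma eval_smoothmx F (sF : smooth_mx U F) p : eval_mx p (smoothmx sF) = F p.
Proof. by apply/matrixP => i j; rewrite !mxE. Qed.

(** The function G is compared with F near p only, hence it may be the
coordinate expression of a map defined on the surface. *)
Lemma eval_deriv (F : 'M[smoothfun]_(m, n)) G p : U p ->
  (\near p, eval_mx p F = G p) -> eval_mx p (map_mx deriv F) = dz G p.
Proof.
move=> Up FG; apply/matrixP => i j; rewrite dzE !mxE /eval_at derivE //.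
by apply: wirtinger_near; apply: filterS FG => q <-; rewrite mxE.
Qed.

Lemma eval_deriv_off (F : 'M[smoothfun]_(m, n)) p : ~ U p ->
  eval_mx p (map_mx deriv F) = 0.
Proof.
by move=> nUp; apply/matrixP => i j; rewrite !mxE /eval_at deriv_off.
Qed.

End Matrices.
End SmoothRing.

(** * Polynomials on the unit circle and coordinate charts *)

Section Circle.
Context {R : realType}.

Lemma conj_unit (l : R[i]) : `|l| = 1 -> (l^* = l^-1)%R.
Proof. by move=> l1; rewrite invC_norm l1 expr1n invr1 mul1r. Qed.

Lemma norm_unitz (l : R[i]) (z : int) : `|l| = 1 -> `|(l ^ z)%R| = 1.
Proof.
by move=> l1; case: z => k; rewrite /exprz ?normfV normrX l1 expr1n ?invr1.
Qed.

(** The Cayley transforms (k + i) / (k - i) of the integers are infinitely many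
points of the unit circle. *)
Lemma circle_poly_eq0 (P : {poly R[i]}) :
  (forall l, `|l| = 1 -> P.[l] = 0) -> P = 0.
Proof.
move=> P0; pose w k : R[i] := k%:R +i* 1; pose z k := w k / (w k)^*.
have w0 k : w k != 0 by rewrite eq_complex /= oner_eq0 andbF.
have z1 k : `|z k| = 1.
  by rewrite normf_div norm_conjC divff ?normr_eq0.
have zI : injective z.
  move=> j k /eqP; rewrite /z eqr_div ?conjC_eq0 // => /eqP.
  move=> /eqP; rewrite eq_complex /=.
  by move=> /andP[_ /eqP jk]; apply/eqP; rewrite -(eqr_nat R); apply/eqP; lra.
apply: (@roots_geq_poly_eq0 _ P (map z (iota 0 (size P)))).
- by apply/allP => _ /mapP[k _ ->]; apply/rootP/P0.
- by rewrite map_inj_uniq ?iota_uniq.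
- by rewrite size_map size_iota.
Qed.

Lemma plane_continuous : continuous (@plane R).
Proof.
move=> p; apply/cvgrPdist_lt => e; rewrite ltcE => /andP[/eqP/= Ime Ree].
have r0 : 0 < complex.Re e / 2 by rewrite divr_gt0.
have /cvgrPdist_lt/(_ _ r0) near1 : (fun t : R * R => t.1) @ p --> p.1.
  exact: cvg_fst.
have /cvgrPdist_lt/(_ _ r0) near2 : (fun t : R * R => t.2) @ p --> p.2.
  exact: cvg_snd.
near=> t.
have norm_real (x : R) : `|x%:C| = `|x|%:C.
  by rewrite normc_def /= expr0n addr0 sqrtr_sqr.
have -> : plane p - plane t = (p.1 - t.1)%:C + 'i%C * (p.2 - t.2)%:C.
  by rewrite [LHS]complexE.
have norm_i : `|'i%C : R[i]| = 1.
  by rewrite normc_def /= expr0n add0r expr1n sqrtr1.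
apply: le_lt_trans (ler_normD _ _) _.
rewrite normrM norm_i mul1r !norm_real -rmorphD /= ltcE /= Ime eqxx /=.
rewrite [ltRHS]splitr; apply: ltrD; near: t; [exact: near1|exact: near2].
Unshelve. all: by end_near. Qed.
End Circle.

Lemma mulmx_cV_eq0 (F : pzRingType) m n (X : 'M[F]_(m, n)) :
  (forall w : 'cV_n, X *m w = 0) -> X = 0.
Proof.
move=> X0; apply/matrixP => z k; have /matrixP/(_ z 0) := X0 (delta_mx k 0).
by rewrite -colE !mxE.
Qed.

Section EvalMatrix.
Context {R : realType} {U : set (R * R)} (openU : open U).

Lemma smoothfunX (f : smoothfun openU) k p :
  smoothfun_val (f ^+ k) p = f p ^+ k.
Proof. exact: (rmorphXn (eval_at p) k f). Qed.

Lemma eval_mulmx m n q p (F : 'M[smoothfun openU]_(m, n))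
    (G : 'M[smoothfun openU]_(n, q)) :
  eval_mx p (F *m G) = eval_mx p F *m eval_mx p G.
Proof. exact: map_mxM. Qed.

Lemma eval_add m n p (F G : 'M[smoothfun openU]_(m, n)) :
  eval_mx p (F + G) = eval_mx p F + eval_mx p G.
Proof. exact: map_mxD. Qed.

Lemma eval_sub m n p (F G : 'M[smoothfun openU]_(m, n)) :
  eval_mx p (F - G) = eval_mx p F - eval_mx p G.
Proof. exact: map_mxB. Qed.

Lemma eval_sum m n k p (F : 'I_k -> 'M[smoothfun openU]_(m, n)) :
  eval_mx p (\sum_j F j) = \sum_j eval_mx p (F j).
Proof. exact: raddf_sum. Qed.

Lemma eval_1 n p : eval_mx p (1%:M : 'M[smoothfun openU]_n) = 1%:M.
Proof. exact: map_mx1. Qed.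

Lemma eval_trmx m n p (F : 'M[smoothfun openU]_(m, n)) :
  eval_mx p F^T = (eval_mx p F)^T.
Proof. by rewrite /eval_mx matrix.map_trmx. Qed.

Lemma eval_bform n p (u w : 'cV[smoothfun openU]_n) :
  smoothfun_val (bform u w) p = ((eval_mx p u)^T *m eval_mx p w) 0 0.
Proof. by rewrite -eval_trmx -eval_mulmx mxE. Qed.

Lemma eval_scale m n p a (F : 'M[smoothfun openU]_(m, n)) :
  eval_mx p (a *: F) = a p *: eval_mx p F.
Proof. by rewrite /eval_mx map_mxZ. Qed.

End EvalMatrix.

Section Chart.
Context {R : realType} {M : riemann_surface R} (c : chart R M).
Hypothesis atlas_c : atlas c.

Lemma plane_codom_open : open (plane_codom c).
Proof.
have [_ oc _ _ _] := atlas_chart atlas_c.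
rewrite (_ : plane_codom c = @plane R @^-1` Defs.codom c) //.
by apply: open_comp oc => p _; exact: plane_continuous.
Qed.

Notation K := (smoothfun plane_codom_open).

Lemma smooth_read m n (F : M -> 'M[R[i]]_(m, n)) :
  smooth_on setT F -> smooth_mx (plane_codom c) (read c F).
Proof.
move=> /(_ _ atlas_c); rewrite (_ : _ `&` _ = plane_codom c) //.
by apply/seteqP; split=> p // [].
Qed.

Definition chart_lift m n (F : M -> 'M[R[i]]_(m, n)) (sF : smooth_on setT F) :
  'M[K]_(m, n) := smoothmx plane_codom_open (smooth_read sF).

Lemma eval_chart_lift m n (F : M -> 'M[R[i]]_(m, n)) (sF : smooth_on setT F) p :
  eval_mx p (chart_lift sF) = read c F p.
Proof. exact: eval_smoothmx. Qed.

End Chart.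

(** * Finite uniton number and the first nonzero product *)

Section SphereChart.
Context {R : realType} {M : riemann_surface R} (c : chart R M).
Hypothesis atlas_c : atlas c.
Notation U := (plane_codom c).
Notation openU := (plane_codom_open atlas_c).
Notation K := (smoothfun openU).
Context {n : nat} {phi : M -> 'cV[R]_n}.
Hypothesis sphere_phi : sphere_map phi.

Definition position : 'cV[K]_n := chart_lift atlas_c (proj1 sphere_phi).

Notation v := position.
Notation D := (map_mx (@deriv _ _ openU)).
Notation A := (rotation (@deriv _ _ openU) v).

Lemma eval_position p : eval_mx p v = complexify phi (param c (plane p)).
Proof. exact: eval_chart_lift. Qed.

Lemma complexify_adjoint x : (complexify phi x)^t* = (complexify phi x)^T.
Proof.
apply/matrixP => i j; rewrite !mxE conj_Creal //.
by rewrite complex_real.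
Qed.

Lemma bform_position : bform v v = 1.
Proof.
apply: smoothfun_eq => p; rewrite eval_bform eval_position /complexify.
rewrite matrix.map_trmx -map_mxM (proj2 sphere_phi) mxE mxE /=.
by rewrite rmorph1.
Qed.

Lemma eval_cartan p :
  read c (cartan (line_bundle phi)) p = eval_mx p (v *m v^T *+ 2 - 1%:M).
Proof.
rewrite /read /cartan /line_bundle complexify_adjoint.
by rewrite mulr2n eval_sub eval_add eval_1 eval_mulmx eval_trmx eval_position
  opprB addrA.
Qed.

Context {N : nat}.
Hypothesis N_gt1 : (1 < N)%N.
Notation jet := (jet (@deriv _ _ openU) v).
Hypothesis isotropic : forall k, (0 < k < N)%N -> bform v (jet k) = 0.

(** As the reflection G is its own inverse, dG = 2 G A gives
A_z = (1/2) G^-1 dG = A. *)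
Lemma eval_rotation p : U p ->
  Az c (cartan (line_bundle phi)) p = eval_mx p A.
Proof.
move=> Up; pose G := reflection v.
have uG : eval_mx p G \in unitmx.
  have /mulmx1_unit[]// : eval_mx p G *m eval_mx p G = 1%:M.
  by rewrite -eval_mulmx reflectionK ?bform_position // eval_1.
rewrite /Az -(@eval_deriv _ _ openU _ _ G) //; last first.
  by near=> q; rewrite eval_cartan.
rewrite (derivation_reflection (@derivM _ _ openU) N_gt1 bform_position) //.
rewrite eval_cartan -/(reflection v) -/G [_ *m _ *+ 2]mulr2n.
rewrite [eval_mx p (_ *m _ + _)]eval_add eval_mulmx.
rewrite mulmxDr mulKmx // scalerDr -scalerDl.
by rewrite -{1 2}[2^-1]div1r -splitr scale1r.
Unshelve. all: by end_near. Qed.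

Lemma iter_deriv_linear m k (a : 'I_k -> R[i]) (w : 'I_k -> 'cV[K]_n) :
  iter m D (\sum_j constfun openU (a j) *: w j) =
  \sum_j constfun openU (a j) *: iter m D (w j).
Proof.
elim: m => //= m ->; rewrite raddf_sum; apply: eq_bigr => j _ /=.
rewrite (derivationZ (@derivM _ _ openU)) [X in X *: _]deriv_const.
by rewrite scale0r add0r.
Qed.

(** With m = qN, the two expressions X_m and Phi^* d^m (Phi v) are paired with v
and multiplied by l^m; their difference is the polynomial P in l, which
vanishes on the unit circle.  The powers in Phi^* d^m (Phi v) lie between
-(r + s) and r + s, whereas X_m contributes its leading coefficient to l^(-2q);
for q = r + s + 1 the latter therefore vanishes. *)
Lemma finite_uniton_jet :
  sphere_finite_uniton_number phi -> bform v (jet N) = 0.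
Proof.
move=> [Phi [[_ uni _ ext] [r [s [C [sC PhiE]]]]]].
pose e j : int := j%:Z - r%:Z; pose CK j := chart_lift atlas_c (sC (e j)).
pose F l : 'M[K]_n := \sum_(j < (r + s).+1) constfun openU (l ^ e j) *: CK j.
have evalF l p : `|l| = 1 -> eval_mx p (F l) = read c (Phi l) p.
  move=> l1; rewrite /read PhiE // /F eval_sum.
  by apply: eq_bigr => j _; rewrite eval_scale eval_chart_lift.
have dF l : `|l| = 1 ->
    D (F l) = (1 - constfun openU l^-1) *: (F l *m A).
  move=> l1; apply: smoothmx_eq => p.
  have [Up|nUp] := pselect (U p).
    rewrite (eval_deriv (G := read c (Phi l)) Up); last first.
      by near=> q; rewrite evalF.
    have [extz _] := ext c atlas_c l p l1 Up.
    have uX : read c (Phi l) p \in unitmx by exact/unitarymx_unit/uni.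
    rewrite -[LHS](mulKVmx uX) extz eval_rotation // eval_scale eval_mulmx.
    by rewrite evalF // scalemxAr.
  have A0 : eval_mx p A = 0.
    rewrite /rotation eval_sub !eval_mulmx !eval_trmx.
    rewrite [eval_mx p (jet 1)]eval_deriv_off //.
    by rewrite trmx0 mulmx0 mul0mx subr0.
  by rewrite eval_deriv_off // eval_scale eval_mulmx A0 mulmx0 scaler0.
apply: smoothfun_eq => p; rewrite -[RHS]/(eval_at p 0) rmorph0.
pose q := (r + s).+1; pose m := (q * N)%N.
pose X := spectral_jet (@deriv _ _ openU) v m.
pose b j := smoothfun_val (bform v (X j)) p.
pose w j := eval_mx p (iter m D (CK j *m v)).
pose a k j := ((eval_mx p v)^T *m (eval_mx p (CK k))^t* *m w j) 0 0.
(* The factor l^m makes all exponents nonnegative. *)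
pose P : {poly R[i]} := \sum_(j < m.+1) b j *: 'X^(m - j) -
  \sum_(k < q) \sum_(j < q) a k j *: 'X^(m + j - k).
have m2q : (2 * q <= m)%N by rewrite mulnC leq_mul2l N_gt1 orbT.
have P0 : P = 0.
  apply: circle_poly_eq0 => l l1.
  have l0 : l != 0 by rewrite -normr_gt0 l1.
  have unitF : (eval_mx p (F l))^t* *m eval_mx p (F l) = 1%:M.
    have uX := uni l (param c (plane p)) l1.
    by rewrite evalF // -invmx_unitary // mulVmx // unitarymx_unit.
  have frame : \sum_(j < q) l ^ e j *: w j =
      eval_mx p (F l) *m \sum_(j < m.+1) l^-1 ^+ j *: eval_mx p (X j).
    have := derivation_frame (@derivM _ _ openU) (ltnSn m)
      (deriv_const openU l^-1) (dF l l1).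
    rewrite /F mulmx_suml; under eq_bigr do rewrite -scalemxAl.
    rewrite iter_deriv_linear => /(congr1 (eval_mx p)).
    rewrite eval_mulmx !eval_sum.
    under eq_bigr do rewrite eval_scale.
    move=> ->; congr (_ *m _); apply: eq_bigr => j _.
    by rewrite eval_scale smoothfunX.
  have series : \sum_(j < m.+1) l^-1 ^+ j * b j =
      \sum_(k < q) \sum_(j < q) (l ^ e k)^* * l ^ e j * a k j.
    have adjF : (eval_mx p (F l))^t* =
        \sum_(k < q) (l ^ e k)^* *: (eval_mx p (CK k))^t*.
      rewrite eval_sum; apply/matrixP => i j; rewrite !mxE !summxE rmorph_sum.
      by apply: eq_bigr => k _; rewrite eval_scale !mxE rmorphM.
    have := congr1 (fun W => ((eval_mx p v)^T *m (eval_mx p (F l))^t* *m W) 0 0)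
      frame.
    rewrite mulmxA -[_ *m _ *m eval_mx p (F l)]mulmxA unitF mulmx1.
    rewrite [in RHS]mulmx_sumr [in RHS]summxE => rhs.
    transitivity (\sum_(j < m.+1)
        ((eval_mx p v)^T *m (l^-1 ^+ j *: eval_mx p (X j))) 0 0).
      by apply: eq_bigr => j _; rewrite -scalemxAr mxE -eval_bform.
    rewrite -rhs adjF -mulmxA mulmx_suml mulmx_sumr summxE.
    apply: eq_bigr => k _; rewrite !mulmx_sumr summxE; apply: eq_bigr => j _.
    by rewrite -scalemxAl -!scalemxAr mulmxA !scalerA mxE.
  rewrite hornerD hornerN !horner_sum.
  transitivity (l ^+ m * (\sum_(j < m.+1) l^-1 ^+ j * b j -
      \sum_(k < q) \sum_(j < q) (l ^ e k)^* * l ^ e j * a k j)); last first.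
    by rewrite series subrr mulr0.
  rewrite mulrBr !mulr_sumr; congr (_ - _); apply: eq_bigr => k _.
    rewrite hornerZ hornerXn mulrC mulrA exprVn.
    by rewrite -expfB_cond // (negPf l0) add0n -ltnS.
  rewrite horner_sum mulr_sumr; apply: eq_bigr => j _.
  rewrite hornerZ hornerXn mulrC !mulrA; congr (_ * _).
  have -> : (l ^ e k)^*%R = (l ^ (- e k))%R.
    by rewrite conj_unit ?invr_expz // norm_unitz.
  rewrite -[l ^+ m]/(l ^ m%:Z)%R -[LHS]/(l ^ (m + j - k)%N%:Z)%R -!expfzDr //.
  congr (l ^ _)%R; have := ltn_ord k.
  by clear -m2q; clearbody m; rewrite /e /q in m2q *; lia.
have : P`_(m - 2 * q) = 0 by rewrite P0 coef0.
rewrite /P coefB !coef_sum [X in _ - X]big1 => [|k _]; last first.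
  rewrite coef_sum big1 // => j _; rewrite coefZ coefXn.
  case: eqP => [|_]; last by rewrite mulr0.
  by have := ltn_ord k; rewrite /q in m2q *; lia.
have lt2q : (2 * q < m.+1)%N by [].
rewrite (bigD1 (Ordinal lt2q)) //= coefZ coefXn eqxx mulr1 subr0.
rewrite big1 ?addr0 => [|j]; last first.
  rewrite -val_eqE /= coefZ coefXn => jq.
  case: eqP => [|_]; last by rewrite mulr0.
  by have := ltn_ord j; lia.
rewrite /b /X.
have [_ ->] := closing_spectral_jet (@derivM _ _ openU) N_gt1 bform_position
  isotropic q.
rewrite bformZr bform_position mulr1 smoothfunX smoothfunM smoothfunX.
move=> /eqP; rewrite expf_eq0 /= mulf_eq0 expf_eq0 => /orP[/andP[_]|/eqP//].
by move=> /eqP N10; have /eqP : - 1 = 0 :> R[i] := N10;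
  rewrite oppr_eq0 oner_eq0.
Unshelve. all: by end_near. Qed.
End SphereChart.

(** * Gauss bundles in a chart *)

Section SmoothMatrices.
Context {R : realType}.

Lemma Ck_subset (V : normedModType R) k (U W : set V) (f : V -> R) :
  W `<=` U -> Ck k U f -> Ck k W f.
Proof.
move=> WU; elim: k f => [|k IH] f /= sf.
  by move=> x; rewrite inE => /WU Ux; apply: sf; rewrite inE.
by move=> v; have [df Df] := sf v; split=> [x /WU/df//|]; apply: IH.
Qed.

Lemma smooth_mx_subset m n (U W : set (R * R)) (F : R * R -> 'M[R[i]]_(m, n)) :
  W `<=` U -> smooth_mx U F -> smooth_mx W F.
Proof.
by move=> WU sF i j; have [sr si] := sF i j; split=> k; exact: Ck_subset (WU) _.
Qed.

Lemma smooth_mx_eval (U : set (R * R)) (openU : open U) m n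
    (F : 'M[smoothfun openU]_(m, n)) : smooth_mx U (fun p => eval_mx p F).
Proof.
move=> i j; have := smoothfun_smooth (F i j); congr (_ /\ _);
  by congr smooth; apply/funext => p; rewrite mxE.
Qed.

Lemma dz_mulmx (U : set (R * R)) (openU : open U) m n q
    (F : R * R -> 'M[R[i]]_(m, n)) (G : R * R -> 'M[R[i]]_(n, q)) p :
  smooth_mx U F -> smooth_mx U G -> U p ->
  dz (fun x => F x *m G x) p = dz F p *m G p + F p *m dz G p.
Proof.
move=> sF sG Up; pose FK := smoothmx openU sF; pose GK := smoothmx openU sG.
rewrite -(@eval_deriv _ _ openU _ _ (FK *m GK)) //; last first.
  by near=> x; rewrite eval_mulmx !eval_smoothmx.
rewrite (derivation_mulmx (@derivM _ _ openU)) eval_add !eval_mulmx.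
by rewrite !eval_smoothmx (@eval_deriv _ _ openU _ _ _ F)
    ?(@eval_deriv _ _ openU _ _ _ G) //;
  near=> x; rewrite eval_smoothmx.
Unshelve. all: by end_near. Qed.

Lemma smooth_mx_cst (U : set (R * R)) m n (F : 'M[R[i]]_(m, n)) :
  open U -> smooth_mx U (cst F).
Proof. by move=> openU i j; apply: (csmooth_cst openU (F i j)). Qed.

Lemma dz_cst m n (F : 'M[R[i]]_(m, n)) p : dz (cst F) p = 0.
Proof. by apply/matrixP => i j; rewrite dzE wirtinger_cst mxE. Qed.

Lemma dz_near m n (F G : R * R -> 'M[R[i]]_(m, n)) p :
  (\near p, F p = G p) -> dz F p = dz G p.
Proof.
move=> FG; apply/matrixP => i j.
have E : wirtinger (fun q => F q i j) p = wirtinger (fun q => G q i j) p.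
  by apply: wirtinger_near; apply: filterS FG => q ->.
exact: etrans (dzE F p i j) (etrans E (esym (dzE G p i j))).
Qed.

End SmoothMatrices.

Section PuncturedNeighbourhoods.
Context {R : realType}.

Lemma punctured_nbhs_neq (p : R * R) (A : set (R * R)) :
  nbhs p A -> exists2 q, A q & q != p.
Proof.
move=> [[A1 A2] /= [pA1 pA2] A12].
have A1' : p.1^' A1 by exact: nbhs_dnbhs.
have [x [A1x xp]] := filter_ex (filterI A1' (nbhs_dnbhs_neq p.1)).
exists (x, p.2); first by apply: A12; split=> //=; exact: nbhs_singleton.
by rewrite -pair_eqE /= negb_and xp.
Qed.

Lemma punctured_eq0 (g : R * R -> R) p : {for p, continuous g} ->
  (\forall q \near p^', g q = 0) -> g p = 0.
Proof.
move=> cg g0; apply/eqP/negPn/negP => gp.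
have gn : \forall q \near p, g q != 0.
  exact: (cvgr_neq0 _ cg gp).
have [q [gq gq0] qp] := punctured_nbhs_neq (filterI gn g0).
by move: gq; rewrite gq0 // eqxx.
Qed.

Lemma smoothfun_punctured (U : set (R * R)) (openU : open U)
    (f : smoothfun openU) p :
  U p -> (\forall q \near p^', f q = 0) -> f p = 0.
Proof.
move=> Up f0; have [/(_ 0%N) cr /(_ 0%N) ci] := smoothfun_smooth f.
have r0 : complex.Re (f p) = 0.
  apply: (@punctured_eq0 (fun q => complex.Re (f q))).
    by apply: cr; rewrite inE.
  by apply: filterS f0 => q ->.
have i0 : complex.Im (f p) = 0.
  apply: (@punctured_eq0 (fun q => complex.Im (f q))).
    by apply: ci; rewrite inE.
  by apply: filterS f0 => q ->.
by case: (f p) r0 i0 => /= ? ? -> ->.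
Qed.

(** Gauss bundles are prescribed away from isolated points; identities between
smooth objects extend over these points by continuity. *)
Lemma smoothmx_punctured (U : set (R * R)) (openU : open U) m n
    (F : 'M[smoothfun openU]_(m, n)) p :
  U p -> (\forall q \near p^', eval_mx q F = 0) -> eval_mx p F = 0.
Proof.
move=> Up F0; apply/matrixP => i j; rewrite !mxE.
apply: smoothfun_punctured => //; apply: filterS F0 => q /matrixP/(_ i j).
by rewrite !mxE.
Qed.

End PuncturedNeighbourhoods.

Section Charts.
Context {R : realType} {M : riemann_surface R} (c : chart R M).
Hypothesis atlas_c : atlas c.
Notation U := (plane_codom c).
Notation openU := (plane_codom_open atlas_c).
Notation at_ p := (param c (plane p)).

Lemma plane_codomP p : U p -> exists2 x, Defs.dom c x &
  [/\ Defs.coord c x = plane p, at_ p = x & plane_coord c x = p].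
Proof.
move=> [x dx xp]; exists x => //; split=> //.
  by have [_ _ _ _ K] := atlas_chart atlas_c; rewrite -xp K ?inE.
by rewrite /plane_coord xp; case: p {xp}.
Qed.

Lemma plane_coordP x : Defs.dom c x ->
  U (plane_coord c x) /\ at_ (plane_coord c x) = x.
Proof.
move=> dx; have xp : plane (plane_coord c x) = Defs.coord c x.
  by rewrite /plane /plane_coord; case: (Defs.coord c x).
split; first by exists x.
by have [_ _ _ _ K] := atlas_chart atlas_c; rewrite xp K ?inE.
Qed.

Lemma param_near p (S : set M) : U p -> nbhs (at_ p) S ->
  \forall q \near p, S (at_ q).
Proof.
move=> Up Sp; have [_ _ _ cp _] := atlas_chart atlas_c.
have cpp : {for plane p, continuous (param c)} by apply: cp; rewrite inE.
exact: (plane_continuous (cpp _ Sp)).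
Qed.

Lemma param_near_punctured p (S : set M) : U p ->
  (\forall y \near (at_ p)^', S y) -> \forall q \near p^', U q /\ S (at_ q).
Proof.
move=> Up Sp; have nU : nbhs p U.
  by apply: open_nbhs_nbhs; split=> //; exact: openU.
have := param_near Up Sp; apply: filterS2 nU => q Uq Sq qp; split=> //.
apply: Sq; apply: contraNneq qp => qp.
have [x _ [xq atx _]] := plane_codomP Up.
have [y _ [yq aty _]] := plane_codomP Uq.
have : plane q = plane p by rewrite -yq -xq -aty -atx qp.
by rewrite /plane => -[q1 q2]; rewrite -pair_eqE /= q1 q2 !eqxx.
Qed.

Context {n : nat}.
Implicit Types P Q : M -> 'M[R[i]]_n.

Lemma smooth_on_read m k (F : M -> 'M[R[i]]_(m, k)) :
  (forall c', atlas c' -> smooth_mx (plane_codom c') (read c' F)) ->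
  smooth_on setT F.
Proof. by move=> sF d ad; apply: smooth_mx_subset (sF d ad) => p []. Qed.

(** For a section s of P, differentiating s = P s shows that (1 - P) ds
= (1 - P) (dP) s depends on the value of s only; and each vector u of a fibre
is the value of the section P u, with u constant. *)
Lemma gauss_imageE P x : subbundle P -> Defs.dom c x ->
  gauss_image P c x = [set v | exists2 u, fibre P x u &
    v = (1%:M - P x) *m (dz (read c P) (plane_coord c x) *m u)].
Proof.
move=> [sP idP] dx; have [Up px] := plane_coordP dx.
set p := plane_coord c x in Up px *.
have readP : read c P p = P x by rewrite /read px.
have sPc := smooth_read atlas_c sP.
apply/seteqP; split=> v /=.
  move=> [W [s [oW Wx [ss Ws] ->]]]; exists (s x); first exact: Ws.
  pose U' := U `&` [set q | W (at_ q)].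
  have openU' : open U'.
    rewrite openE => q [Uq Wq]; apply: filterI.
      by apply: open_nbhs_nbhs; split=> //; exact: openU.
    by apply: (param_near Uq); apply: open_nbhs_nbhs.
  have U'p : U' p by split; rewrite //= px.
  have -> : dz (read c s) p = dz (fun q => read c P q *m read c s q) p.
    apply: dz_near; near=> q; rewrite /read (_ : P _ *m s _ = s (at_ q)) //.
    apply: Ws; near: q; apply: (param_near Up).
    by rewrite px; apply: open_nbhs_nbhs.
  have sP' := smooth_mx_subset (@subIsetl _ U [set q | W (at_ q)]) sPc.
  rewrite (dz_mulmx openU' sP' (ss c atlas_c) U'p) mulmxDr readP.
  have PP : (1%:M - P x) *m P x = 0.
    by rewrite mulmxBl mul1mx (proj1 (idP x)) subrr.
  rewrite [X in _ + X]mulmxA PP mul0mx addr0.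
  by rewrite /read px.
move=> [u ux ->]; exists setT, (fun y => P y *m u); split => //.
- exact: openT.
- split=> [|y _]; last by rewrite /fibre /= mulmxA (proj1 (idP y)).
  apply: smooth_on_read => d ad.
  pose uK : 'cV[smoothfun (plane_codom_open ad)]_n := map_mx (constfun _) u.
  have := smooth_mx_eval (chart_lift ad sP *m uK); congr smooth_mx.
  apply/funext => q.
  rewrite eval_mulmx eval_chart_lift; congr (_ *m _).
  by apply/matrixP => i j; rewrite !mxE.
- congr (_ *m _); rewrite -/p.
  have := dz_mulmx openU sPc (smooth_mx_cst u openU) Up.
  by rewrite dz_cst mulmx0 addr0.
Unshelve. all: by end_near. Qed.
End Charts.

(** * The harmonic sequence of the position vector *)

Section HarmonicSequence.
Context {R : realType} {M : riemann_surface R} (c : chart R M).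
Hypothesis atlas_c : atlas c.
Notation U := (plane_codom c).
Notation openU := (plane_codom_open atlas_c).
Notation K := (smoothfun openU).
Notation D := (map_mx (@deriv _ _ openU)).
Notation at_ p := (param c (plane p)).
Context {n : nat} {phi : M -> 'cV[R]_n} (sphere_phi : sphere_map phi).
Variables (B : nat -> M -> 'M[R[i]]_n) (T : nat).
Hypothesis subB : forall i, subbundle (B i).
Hypothesis B0 : B 0 = line_bundle phi.
Hypothesis gaussB : forall i, (i < T)%N -> is_gauss_bundle (B i) (B i.+1).

Notation v := (position atlas_c sphere_phi).
Notation jet := (jet (@deriv _ _ openU) v).

Definition projector i : 'M[K]_n := chart_lift atlas_c (proj1 (subB i)).

Lemma eval_projector i p : eval_mx p (projector i) = B i (at_ p).
Proof. exact: eval_chart_lift. Qed.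

Lemma projector_idem i : projector i *m projector i = projector i.
Proof.
apply: smoothmx_eq => p; rewrite eval_mulmx eval_projector.
by have [_ /(_ (at_ p)) []] := subB i.
Qed.

Lemma projector0E : projector 0 = v *m v^T.
Proof.
apply: smoothmx_eq => p; rewrite eval_mulmx eval_trmx eval_projector B0.
by rewrite eval_position /line_bundle complexify_adjoint.
Qed.

Definition gauss_step i (s : 'cV[K]_n) : 'cV[K]_n :=
  (1%:M - projector i) *m D s.

Lemma derivation_section i s : D s = gauss_step i s + projector i *m D s.
Proof. by rewrite /gauss_step mulmxBl mul1mx addrNK. Qed.

Lemma gauss_stepE i s : projector i *m s = s ->
  gauss_step i s = (1%:M - projector i) *m (D (projector i) *m s).
Proof.
move=> ps; rewrite /gauss_step -{1}ps (derivation_mulmx (@derivM _ _ openU)).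
rewrite mulmxDr [X in _ + X]mulmxA.
have -> : (1%:M - projector i) *m projector i = 0.
  by rewrite mulmxBl mul1mx projector_idem subrr.
by rewrite mul0mx addr0.
Qed.

Lemma eval_gauss_step i s p : U p -> projector i *m s = s ->
  eval_mx p (gauss_step i s) =
  (1%:M - B i (at_ p)) *m (dz (read c (B i)) p *m eval_mx p s).
Proof.
move=> Up ps; rewrite gauss_stepE // !eval_mulmx eval_sub eval_1 eval_projector.
congr (_ *m (_ *m _)); apply: eval_deriv => //.
by near=> q; rewrite eval_projector.
Unshelve. all: by end_near. Qed.

Lemma gauss_near i p : (i < T)%N -> U p -> \forall q \near p^', U q /\
  fibre (B i.+1) (at_ q) = [set w | exists2 u, fibre (B i) (at_ q) u &
    w = (1%:M - B i (at_ q)) *m (dz (read c (B i)) q *m u)].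
Proof.
move=> iT Up; have [_ /(_ c atlas_c) gB] := gaussB iT.
have [x dx [_ px _]] := plane_codomP atlas_c Up.
have := param_near_punctured atlas_c Up.
have := gB x dx; rewrite -{1}px => gBx /(_ _ gBx).
apply: filterS => q [Uq gq]; split=> //; rewrite -gq.
have [y dy [_ aty py]] := plane_codomP atlas_c Uq.
by rewrite aty (gauss_imageE atlas_c (subB i) dy) py.
Qed.

(** By the definition of the Gauss bundle this holds at the points of a
punctured neighbourhood. *)
Lemma projector_gauss_step i s : (i < T)%N -> projector i *m s = s ->
  projector i.+1 *m gauss_step i s = gauss_step i s.
Proof.
move=> iT ps; apply/eqP; rewrite -subr_eq0; apply/eqP/smoothmx_eq => p.
have [Up|nUp] := pselect (U p); last first.
  rewrite !(eval_sub, eval_mulmx) eval_deriv_off // !mulmx0 subrr.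
  by rewrite /eval_mx map_mx0.
rewrite [RHS]/eval_mx map_mx0; apply: smoothmx_punctured => //.
apply: filterS (gauss_near iT Up) => q [Uq gq].
rewrite eval_sub eval_mulmx eval_projector.
suff : fibre (B i.+1) (at_ q) (eval_mx q (gauss_step i s)).
  by rewrite /fibre /= => ->; rewrite subrr.
rewrite gq; exists (eval_mx q s); last exact: eval_gauss_step.
by rewrite /fibre /= -eval_projector -eval_mulmx ps.
Qed.

Fixpoint gauss_section i : 'cV[K]_n :=
  if i is i'.+1 then gauss_step i' (gauss_section i') else v.

Lemma projector_gauss_section i : (i <= T)%N ->
  projector i *m gauss_section i = gauss_section i.
Proof.
elim: i => [|i IH] iT.
  by rewrite projector0E mulmx_bform bform_position scale1r.
by apply: projector_gauss_step => //; apply/IH/ltnW.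
Qed.

(** The line bundle of v has rank one, and the fibre of the next bundle is the
image of the fibre under (1 - B i) (dz B i), a map that takes each section
[gauss_section i] to the following one. *)
Lemma fibre_near i p : (i <= T)%N -> U p -> \forall q \near p^',
  forall w, fibre (B i) (at_ q) w ->
  exists a, w = a *: eval_mx q (gauss_section i).
Proof.
move=> + Up; elim: i => [|i IH] iT.
  near=> q => w; rewrite /fibre /= B0 -{1}B0 -(eval_projector 0) projector0E.
  rewrite eval_mulmx eval_trmx -mulmxA => vw.
  exists (((eval_mx q v)^T *m w) 0 0).
  by rewrite -mul_mx_scalar -mx11_scalar.
apply: filterS2 (IH (ltnW iT)) (gauss_near iT Up) => q sp [Uq ->] w.
move=> [u /sp[a ->] ->].
exists a; rewrite /= eval_gauss_step ?projector_gauss_section 1?ltnW //.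
by rewrite -!scalemxAr.
Unshelve. all: by end_near. Qed.

Hypothesis orthB : forall i, (0 < i < T)%N -> forall x,
  (complexify phi x)^T *m B i x = 0.

Lemma bform_section i s : (0 < i < T)%N -> projector i *m s = s ->
  bform v s = 0.
Proof.
move=> iT <-; apply: smoothfun_eq => p.
rewrite eval_bform eval_mulmx eval_position eval_projector mulmxA orthB //.
by rewrite mul0mx mxE.
Qed.

(** Being a sum of sections of B 1, ..., B i, encoded by peeling off the last
summand so that inductions on i follow the definition. *)
Fixpoint in_span i (u : 'cV[K]_n) : Prop :=
  if i is i'.+1 then
    exists2 s, projector i *m s = s & in_span i' (u - s)
  else u = 0.

Lemma in_span_sub i u : in_span i u -> in_span i.+1 u.
Proof. by move=> iu; exists 0; rewrite ?mulmx0 ?subr0. Qed.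

Lemma in_spanD i u w : in_span i u -> in_span i w -> in_span i (u + w).
Proof.
elim: i u w => [|i IH] u w /=; first by move=> -> ->; rewrite addr0.
move=> [s ps us] [s' ps' ws]; exists (s + s'); first by rewrite mulmxDr ps ps'.
by rewrite opprD addrACA; apply: IH.
Qed.

Lemma in_span0 i : in_span i 0.
Proof. by elim: i => // i /in_span_sub. Qed.

Lemma in_span_section i s : projector i.+1 *m s = s -> in_span i.+1 s.
Proof. by move=> ps; exists s; rewrite ?subrr //; exact: in_span0. Qed.

(** The component of the derivative of a section of B j orthogonal to B j is a
section of the Gauss bundle B (j + 1). *)
Lemma in_span_deriv i u : (i < T)%N -> in_span i u -> in_span i.+1 (D u).
Proof.
elim: i u => [|i IH] u iT; first by move=> ->; rewrite map_mx0; exact: in_span0.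
move=> [s ps us]; rewrite -(subrK s u) raddfD; apply: in_spanD.
  by apply/in_span_sub/IH => //; exact: ltnW.
rewrite [X in in_span _ X](derivation_section i.+1); apply: in_spanD.
  exact/in_span_section/projector_gauss_step.
by apply/in_span_sub/in_span_section; rewrite mulmxA projector_idem.
Qed.

Lemma bform_in_span i u : (i < T)%N -> in_span i u -> bform v u = 0.
Proof.
elim: i u => [|i IH] u iT; first by move=> ->; rewrite bform0r.
move=> [s ps us]; rewrite -(subrK s u) bformDr (IH _ (ltnW iT)) //.
by rewrite (@bform_section i.+1) ?addr0.
Qed.

Lemma bform_jet1 : bform v (jet 1) = 0.
Proof.
have := derivation_bform (@derivM _ _ openU) v v.
rewrite bform_position (derivation1 (@derivM _ _ openU)).
rewrite [X in X + _]bformC => /esym d0; apply: smoothfun_eq => p.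
have /eqP : smoothfun_val (bform v (jet 1) + bform v (jet 1)) p = 0.
  by rewrite [_ + _]d0.
by rewrite smoothfunD -mulr2n mulrn_eq0 => /eqP.
Qed.

(** Differentiating repeatedly, the part of d^(i+1) v outside the lower bundles
is the section of B (i + 1) obtained by taking the Gauss step each time. *)
Lemma jet_sub_gauss_section i : (i < T)%N ->
  in_span i (jet i.+1 - gauss_section i.+1).
Proof.
elim: i => [|i IH] iT.
  rewrite /= /gauss_step mulmxBl mul1mx opprB addrC subrK projector0E.
  by rewrite mulmx_bform bform_jet1 scale0r.
have -> : jet i.+2 - gauss_section i.+2 =
    D (jet i.+1 - gauss_section i.+1) +
    projector i.+1 *m D (gauss_section i.+1).
  rewrite [in RHS]raddfB [X in _ = _ - X + _](derivation_section i.+1).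
  by rewrite opprD addrA addrNK.
apply: in_spanD; first exact/in_span_deriv/IH/ltnW/iT/ltnW.
by apply: in_span_section; rewrite mulmxA projector_idem.
Qed.

Lemma bform_jet i : (0 < i < T)%N -> bform v (jet i) = 0.
Proof.
case: i => // i iT; have iT' : (i.+1 < T)%N by [].
rewrite -(subrK (gauss_section i.+1) (jet i.+1)) bformDr.
rewrite (bform_in_span (ltnW iT') (jet_sub_gauss_section (ltnW iT'))) add0r.
by rewrite (bform_section iT) // projector_gauss_section // ltnW.
Qed.

(** Under the orthogonality of the lower bundles, (v, d^T v) is the product of v
with the section that spans B T at generic points. *)
Lemma bform_jet_last : (0 < T)%N -> bform v (jet T) = 0 ->
  forall x, Defs.dom c x -> (complexify phi x)^T *m B T x = 0.
Proof.
move=> T0 jT x dx; have [Up px] := plane_coordP atlas_c dx.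
set p := plane_coord c x in Up px.
have fT : bform v (gauss_section T) = 0.
  have iT : (T.-1 < T)%N by rewrite prednK.
  rewrite -jT -(prednK T0).
  rewrite -[in RHS](subrK (gauss_section T.-1.+1) (jet T.-1.+1)) bformDr.
  by rewrite (bform_in_span iT (jet_sub_gauss_section iT)) add0r.
have -> : (complexify phi x)^T *m B T x = eval_mx p (v^T *m projector T).
  by rewrite eval_mulmx eval_trmx eval_projector eval_position px.
apply: smoothmx_punctured => //.
apply: filterS (fibre_near (leqnn T) Up) => q spq.
apply: mulmx_cV_eq0 => w; rewrite eval_mulmx eval_trmx eval_projector -mulmxA.
have [|a ->] := spq (B T (at_ q) *m w).
  by rewrite /fibre /= mulmxA; have [_ /(_ (at_ q)) [-> _]] := subB T.
by rewrite -scalemxAr [_ *m _]mx11_scalar -eval_bform fT raddf0 scaler0.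
Qed.
End HarmonicSequence.

(** * Finite isotropy order *)

Section GaussBundles.
Context {R : realType} {M : riemann_surface R} {n : nat}.
Implicit Types P : M -> 'M[R[i]]_n.

Lemma gauss_bundleP P :
  is_gauss_bundle P (gauss_bundle P) \/ gauss_bundle P = fun=> 0.
Proof.
have [[Q PQ]|nP] := pselect (exists Q, is_gauss_bundle P Q).
  by left; apply: (xgetPex _ (ex_intro _ Q PQ)).
by right; apply: xgetPN => Q PQ; apply: nP; exists Q.
Qed.

Lemma subbundle0 : subbundle ((fun=> 0) : M -> 'M[R[i]]_n).
Proof.
split=> [|x]; last by rewrite mulmx0 trmx0 map_mx0.
apply: smooth_on_read => c ac.
exact: (smooth_mx_cst 0 (plane_codom_open ac)).
Qed.

Lemma subbundle_gauss_bundle P : subbundle (gauss_bundle P).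
Proof. by have [[]//|->] := gauss_bundleP P; exact: subbundle0. Qed.

(** A Gauss bundle of the zero bundle has zero fibres away from isolated points,
hence is zero by continuity. *)
Lemma gauss_bundle0 : gauss_bundle ((fun=> 0) : M -> 'M[R[i]]_n) = fun=> 0.
Proof.
have [gQ|//] := gauss_bundleP (fun=> 0); set Q := gauss_bundle _ in gQ *.
apply/funext => x; have [c ac dx] := atlas_cover x.
have [Up px] := plane_coordP ac dx; pose B i := if i is 0 then (fun=> 0) else Q.
have subB i : subbundle (B i).
  by case: i => [|i]; [exact: subbundle0|exact: (proj1 gQ)].
have gB i : (i < 1)%N -> is_gauss_bundle (B i) (B i.+1) by case: i.
have near0 := gauss_near ac subB gB (ltn0Sn 0) Up.
have Q_eq0 := smoothmx_punctured (F := chart_lift ac (proj1 (subB 1%N))) Up.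
rewrite -px -[LHS]/(read c Q _) -(eval_chart_lift ac (proj1 (subB 1%N)));
  apply: Q_eq0.
apply: filterS near0 => q [Uq fq]; rewrite eval_chart_lift /read.
apply: mulmx_cV_eq0 => w; set y := param c (plane q).
have : fibre (B 1%N) y (Q y *m w).
  by rewrite /fibre /= mulmxA; have [_ /(_ y) [-> _]] := subB 1%N.
by rewrite /y fq => -[u]; rewrite /fibre /= mul0mx => <- ->;
  rewrite !mulmx0.
Qed.

Lemma iter_gauss_bundle0 P i k : iter i (@gauss_bundle R M n) P = (fun=> 0) ->
  (i <= k)%N -> iter k (@gauss_bundle R M n) P = fun=> 0.
Proof.
move=> Pi /subnK <-; rewrite iterD Pi; elim: (k - i)%N => // j IH.
by rewrite iterS IH gauss_bundle0.
Qed.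

Lemma orthogonal_bundles0 P : orthogonal_bundles P (fun=> 0).
Proof. by move=> x u w _; rewrite /fibre /= mul0mx => <-; rewrite mulmx0. Qed.

(** If the sequence of Gauss bundles broke off at some stage i <= t, all further
members would be zero and the isotropy order would be infinite. *)
Lemma isotropy_order_gauss P t i : isotropy_order P t -> (i <= t)%N ->
  is_gauss_bundle (iter i (@gauss_bundle R M n) P)
    (iter i.+1 (@gauss_bundle R M n) P).
Proof.
move=> [_ iso maxt] it.
have [//|P0] := gauss_bundleP (iter i (@gauss_bundle R M n) P).
suff /maxt : isotropic_upto P t.+1 by rewrite ltnn.
move=> k /andP[k0 kt]; have [ki|ik] := leqP k i.
  by apply: iso; rewrite k0 (leq_trans ki).
by rewrite (@iter_gauss_bundle0 P i.+1) //; exact: orthogonal_bundles0.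
Qed.

End GaussBundles.

Section Main.
Context {R : realType} {M : riemann_surface R} {n : nat}.
Variable phi : M -> 'cV[R]_n.
Hypothesis sphere_phi : sphere_map phi.

Lemma complexify_norm x : (complexify phi x)^T *m complexify phi x = 1%:M.
Proof.
by rewrite /complexify matrix.map_trmx -map_mxM (proj2 sphere_phi) map_mx1.
Qed.

Lemma subbundle_line_bundle : subbundle (line_bundle phi).
Proof.
split=> [|x].
  apply: smooth_on_read => c ac.
  have := smooth_mx_eval (position ac sphere_phi *m (position ac sphere_phi)^T).
  congr smooth_mx; apply/funext => p.
  rewrite eval_mulmx eval_trmx eval_position /read /line_bundle.
  by rewrite complexify_adjoint.
rewrite /line_bundle complexify_adjoint; split.
  by rewrite mulmxA -[_ *m _ *m complexify _ _]mulmxA complexify_norm mulmx1.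
rewrite trmx_mul trmxK map_mxM /= complexify_adjoint; congr (_ *m _).
by rewrite -[RHS]trmxK -complexify_adjoint -matrix.map_trmx trmxK.
Qed.

Lemma orthogonal_line_bundle P : subbundle P ->
  orthogonal_bundles (line_bundle phi) P <->
  forall x, (complexify phi x)^T *m P x = 0.
Proof.
move=> [_ idP]; split=> [orth x|orth x u w].
  have vx : fibre (line_bundle phi) x (complexify phi x).
    rewrite /fibre /= /line_bundle complexify_adjoint -mulmxA.
    by rewrite complexify_norm mulmx1.
  apply: mulmx_cV_eq0 => w; rewrite -mulmxA -complexify_adjoint.
  by rewrite (orth x _ _ vx) // /fibre /= mulmxA (proj1 (idP x)).
rewrite /fibre /= => <- <-; rewrite /line_bundle complexify_adjoint.
rewrite !trmx_mul trmxK !map_mxM /= complexify_adjoint -!mulmxA.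
by rewrite [_^T *m (P x *m w)]mulmxA orth mul0mx !mulmx0.
Qed.

(** In every chart, the isotropy up to order t makes the first product that can
be nonzero (v, d^(t+1) v), and finiteness of the uniton number makes it zero.
Then the line bundle is also orthogonal to the Gauss bundle of index t + 1,
against the maximality of t. *)
Theorem isotropy_order_not_finite_uniton t :
  isotropy_order (line_bundle phi) t -> ~ sphere_finite_uniton_number phi.
Proof.
move=> iso_t fin; pose B i := iter i (@gauss_bundle R M n) (line_bundle phi).
have subB i : subbundle (B i).
  case: i => [|i]; [exact: subbundle_line_bundle|exact: subbundle_gauss_bundle].
have gB i : (i < t.+1)%N -> is_gauss_bundle (B i) (B i.+1).
  exact: (isotropy_order_gauss iso_t).
have [t1 iso maxt] := iso_t.
have orthB i : (0 < i < t.+1)%N -> forall x, (complexify phi x)^T *m B i x = 0.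
  by move=> it; apply/(orthogonal_line_bundle (subB i))/iso.
suff /maxt : isotropic_upto (line_bundle phi) t.+1 by rewrite ltnn.
move=> k /andP[k0]; rewrite leq_eqVlt => /orP[/eqP ->|kt]; last first.
  by apply: iso; rewrite k0.
apply/(orthogonal_line_bundle (subB t.+1)) => x.
have [c ac dx] := atlas_cover x.
have B0 : B 0 = line_bundle phi by [].
have iso_jet := @bform_jet _ _ c ac n phi sphere_phi B t.+1 subB B0 gB orthB.
have jT := finite_uniton_jet (N := t.+1) t1 iso_jet fin.
exact: (bform_jet_last subB B0 gB orthB (ltn0Sn t) jT dx).
Qed.
End Main.

Theorem corollary4p16 (R : realType) (M : riemann_surface R) (n : nat)
    (phi : M -> 'cV[R]_n) :
  superconformal phi -> ~ sphere_finite_uniton_number phi.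
Proof.
by move=> [[sphere_phi _] /(isotropy_order_not_finite_uniton sphere_phi)].
Qed.
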